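(* Let $0\le\alpha_1,\alpha_2<1/2$ and let $A$ be an $n\times n$ adjacency matrix containing a set $F\subseteq[n]$ satisfying $(\alpha_1,\alpha_2,p)$-regularity. Let \[ \hat S=\arg\min_{S\subseteq[n]:\ |S|\ge n/2}\|(A-p_S)_{S\times S}\|. \] Then $\|(A-p_{\hat S})_{\hat S\times\hat S}\|\le 2n\cdot\eta(p,n)$ and $|p_{\hat S}-p|\le\frac{3}{1/2-\alpha_1}\cdot\eta(p,n)$.
   Context: Fix constants $c,c_1>0$; $\eta(p,n)=c\max\left(\sqrt{p(1-p)/n},\ \sqrt{\ln n}/n\right)$, $\kappa(\alpha,p,n)=c_1\max\left(\alpha\sqrt{\tfrac pn\ln\tfrac e\alpha},\ \tfrac\alpha n\ln\tfrac e\alpha,\ \tfrac{\sqrt{p\ln n}}{n}\right)$. For a matrix $M$ and $a\in\mathbb R$, $M-a$ subtracts $a$ entrywise; $M_{S\times S'}$ agrees with $M$ on $S\times S'$ and is zero elsewhere; $\|\cdot\|$ is the spectral norm; $p_S=\sum_{i,j\in S}A_{i,j}/|S|^2$. A set $F\subseteq[n]$ satisfies $(\alpha_1,\alpha_2,p)$-regularity if: (i) $|[n]\setminus F|\le\alpha_1 n$; (ii) for all $F'\subseteq F$, $\|(A-p)_{F'\times F'}\|\le n\eta(p,n)$; (iii) for all $F',F''\subseteq F$ with $|F'|,|F''|\in[0,\alpha_2n]\cup[n-\alpha_2n,n]$, $\left|\sum_{i\in F'}\sum_{j\in F''}(A_{i,j}-p)\right|\le n^2\kappa(\alpha_2,p,n)$.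 *)

(* Defs.v *)
From mathcomp Require Import all_boot all_order all_algebra.
From mathcomp Require Import classical_sets reals sequences exp.

Set Implicit Arguments.
Unset Strict Implicit.
Unset Printing Implicit Defensive.

Import Order.TTheory GRing.Theory Num.Theory.

Local Open Scope ring_scope.

Definition l2norm (R : realType) (n : nat) (x : 'cV[R]_n) : R :=
  Num.sqrt (\sum_(i < n) x i 0 ^+ 2).

Definition spectral_norm (R : realType) (m n : nat) (M : 'M[R]_(m, n)) : R :=
  sup [set r : R | exists2 x : 'cV[R]_n, l2norm x <= 1 & r = l2norm (M *m x)]%classic.

Definition mx_subc (R : realType) (m n : nat) (M : 'M[R]_(m, n)) (a : R)
    : 'M[R]_(m, n) :=
  \matrix_(i, j) (M i j - a).

(* The dimensions are unchanged: entries outside S x S' are set to zero. *)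
Definition mx_restrict (R : realType) (m n : nat) (M : 'M[R]_(m, n))
    (S : {set 'I_m}) (S' : {set 'I_n}) : 'M[R]_(m, n) :=
  \matrix_(i, j) (if (i \in S) && (j \in S') then M i j else 0).

Definition adjacency_matrix (R : realType) (n : nat) (A : 'M[R]_n) : Prop :=
  [/\ forall i j, A i j = 0 \/ A i j = 1,
      forall i j, A i j = A j i
    & forall i, A i i = 0].

Definition density (R : realType) (n : nat) (A : 'M[R]_n) (S : {set 'I_n}) : R :=
  (\sum_(i in S) \sum_(j in S) A i j) / #|S|%:R ^+ 2.

Definition eta (R : realType) (c p : R) (n : nat) : R :=
  c * Num.max (Num.sqrt (p * (1 - p) / n%:R)) (Num.sqrt (ln n%:R) / n%:R).

(* At alpha = 0 the first two terms vanish, which agrees with their limits. *)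
Definition kappa (R : realType) (c1 alpha p : R) (n : nat) : R :=
  c1 * Num.max (alpha * Num.sqrt (p / n%:R * ln (expR 1 / alpha)))
        (Num.max (alpha / n%:R * ln (expR 1 / alpha))
                 (Num.sqrt (p * ln n%:R) / n%:R)).

Definition extreme_size (R : realType) (alpha : R) (n : nat) (S : {set 'I_n})
    : Prop :=
  (0 <= (#|S|%:R : R) <= alpha * n%:R) \/
  (n%:R - alpha * n%:R <= (#|S|%:R : R) <= n%:R).

Definition regular_set (R : realType) (c c1 : R) (n : nat) (A : 'M[R]_n)
    (alpha1 alpha2 p : R) (F : {set 'I_n}) : Prop :=
  [/\ #|~: F|%:R <= alpha1 * n%:R,
      forall F' : {set 'I_n}, F' \subset F ->
        spectral_norm (mx_restrict (mx_subc A p) F' F') <= n%:R * eta c p n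
    & forall F' F'' : {set 'I_n}, F' \subset F -> F'' \subset F ->
        extreme_size alpha2 F' -> extreme_size alpha2 F'' ->
        `|\sum_(i in F') \sum_(j in F'') (A i j - p)|
          <= n%:R ^+ 2 * kappa c1 alpha2 p n].

Definition centered_norm (R : realType) (n : nat) (A : 'M[R]_n)
    (S : {set 'I_n}) : R :=
  spectral_norm (mx_restrict (mx_subc A (density A S)) S S).

(* The argmin need not be unique: S is any one of the minimizers. *)
Definition is_argmin_centered_norm (R : realType) (n : nat) (A : 'M[R]_n)
    (S : {set 'I_n}) : Prop :=
  n%:R / 2 <= #|S|%:R :> R /\
  forall S' : {set 'I_n}, n%:R / 2 <= #|S'|%:R :> R ->
    centered_norm A S <= centered_norm A S'.

(* Main.v *)
Require Import Defs.
From mathcomp Require Import all_boot all_order all_algebra.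
From mathcomp Require Import classical_sets reals sequences exp.
From mathcomp Require Import ring lra.

Import Order.TTheory GRing.Theory Num.Theory.

Local Open Scope ring_scope.

(**
  Testing [(A - a)_(S x S)] against the indicator vector of [T \subset S] gives
  [`|\sum_(T x T) (A - a)| <= `|(A - a)_(S x S)| * #|T|].  For [S = T = F] and
  [a = p] this bounds [density A F - p], so replacing [p] by [density A F]
  costs at most another [n * eta], whence the first bound by minimality.  For
  the second, let [T] be the intersection of [F] and [Shat], which has at least
  [(1/2 - alpha1) * n] elements: subtracting the estimates for
  [(F, p)] and [(Shat, density A Shat)] leaves
  [#|T|^2 * `|density A Shat - p| <= 3 * n * eta * #|T|].
*)

Definition dot {R : realType} {n : nat} (u v : 'cV[R]_n) : R :=
  \sum_i u i 0 * v i 0.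

Definition indicator {R : realType} {n : nat} (S : {set 'I_n}) : 'cV[R]_n :=
  \col_i (i \in S)%:R.

Section SpectralNorm.
Context {R : realType}.

Lemma l2norm_ge0 n (x : 'cV[R]_n) : 0 <= l2norm x.
Proof. exact: sqrtr_ge0. Qed.

Lemma l2normE n (x : 'cV[R]_n) : l2norm x = Num.sqrt (dot x x).
Proof. by congr Num.sqrt; apply: eq_bigr => i _; rewrite expr2. Qed.

Lemma dot_ge0 n (x : 'cV[R]_n) : 0 <= dot x x.
Proof. by apply: sumr_ge0 => i _; rewrite -expr2 sqr_ge0. Qed.

Lemma dotvv n (x : 'cV[R]_n) : dot x x = l2norm x ^+ 2.
Proof. by rewrite l2normE sqr_sqrtr // dot_ge0. Qed.

Lemma dotC n (u v : 'cV[R]_n) : dot u v = dot v u.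
Proof. by apply: eq_bigr => i _; rewrite mulrC. Qed.

(** Lagrange's identity: the double sum of the squares of [u i 0 * v j 0 - u j 0 * v i 0] is twice
    the gap between the two squared sides. *)
Lemma cauchy_schwarz n (u v : 'cV[R]_n) :
  `|dot u v| <= l2norm u * l2norm v.
Proof.
have sq : dot u v ^+ 2 <= dot u u * dot v v.
  have : 0 <= \sum_i \sum_j (u i 0 * v j 0 - u j 0 * v i 0) ^+ 2.
    by apply: sumr_ge0 => i _; apply: sumr_ge0 => j _; rewrite sqr_ge0.
  have -> : \sum_i \sum_j (u i 0 * v j 0 - u j 0 * v i 0) ^+ 2 =
            2 * (dot u u * dot v v - dot u v ^+ 2).
    transitivity (\sum_i (u i 0 * u i 0 * dot v v + v i 0 * v i 0 * dot u u
                          - 2 * (u i 0 * v i 0) * dot u v)).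
      apply: eq_bigr => i _.
      rewrite /dot !mulr_sumr -big_split -sumrB /=.
      by apply: eq_bigr => j _; ring.
    rewrite sumrB big_split /= -!mulr_suml -mulr_sumr -!/(dot _ _).
    by ring.
  lra.
rewrite !l2normE -sqrtrM ?dot_ge0// -sqrtr_sqr.
by rewrite ler_sqrt // mulr_ge0 ?dot_ge0.
Qed.

(** Cauchy-Schwarz on each row. The Frobenius norm is needed only as a finite upper bound for the
    set whose [sup] defines [spectral_norm]. *)
Lemma l2norm_mulmx_frobenius m n (M : 'M[R]_(m, n)) (x : 'cV[R]_n) :
  l2norm x <= 1 ->
  l2norm (M *m x) <= Num.sqrt (\sum_i dot (row i M)^T (row i M)^T).
Proof.
move=> x1; rewrite l2normE; apply: ler_wsqrtr; apply: ler_sum => i _.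
have -> : (M *m x) i 0 = dot (row i M)^T x.
  by rewrite mxE; apply: eq_bigr => j _; rewrite !mxE.
rewrite -expr2 -real_normK ?num_real // dotvv lerXn2r ?nnegrE ?l2norm_ge0 //.
by apply: le_trans (cauchy_schwarz _ _ _) _; rewrite ler_piMr ?l2norm_ge0.
Qed.

Lemma l2norm0 n : l2norm (0 : 'cV[R]_n) = 0.
Proof.
by rewrite l2normE /dot big1 ?sqrtr0 // => i _; rewrite mxE mul0r.
Qed.

Lemma l2normZ n (a : R) (x : 'cV[R]_n) : l2norm (a *: x) = `|a| * l2norm x.
Proof.
rewrite !l2normE -sqrtr_sqr -sqrtrM ?sqr_ge0 //; congr Num.sqrt.
by rewrite /dot mulr_sumr; apply: eq_bigr => i _; rewrite !mxE; ring.
Qed.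

Lemma l2norm_eq0 n (x : 'cV[R]_n) : l2norm x = 0 -> x = 0.
Proof.
move=> x0; have : dot x x = 0 by rewrite dotvv x0 expr0n.
move/eqP; rewrite psumr_eq0 => [/allP x0i|i _]; last by rewrite -expr2 sqr_ge0.
apply/colP => i; rewrite mxE; apply/eqP.
by have := x0i i (mem_index_enum i); rewrite mulf_eq0 orbb.
Qed.

Lemma spectral_norm_le m n (M : 'M[R]_(m, n)) (b : R) :
  (forall x, l2norm x <= 1 -> l2norm (M *m x) <= b) -> spectral_norm M <= b.
Proof.
(* The zero vector shows that the set under the [sup] is nonempty. *)
move=> hb; apply: ge_sup; first by exists (l2norm (M *m 0)), 0; rewrite ?l2norm0.
by move=> _ [x x1 ->]; exact: hb.
Qed.

Lemma l2norm_mulmx_unit_ball m n (M : 'M[R]_(m, n)) (x : 'cV[R]_n) :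
  l2norm x <= 1 -> l2norm (M *m x) <= spectral_norm M.
Proof.
move=> x1; apply: ub_le_sup; last by exists x.
exists (Num.sqrt (\sum_i dot (row i M)^T (row i M)^T)).
by move=> _ [z z1 ->]; exact: l2norm_mulmx_frobenius.
Qed.

Lemma spectral_norm_ge0 m n (M : 'M[R]_(m, n)) : 0 <= spectral_norm M.
Proof.
apply: le_trans (l2norm_mulmx_unit_ball _ _ M 0 _); first exact: l2norm_ge0.
by rewrite l2norm0.
Qed.

(** By homogeneity: a nonzero [x] is rescaled to length 1, and the zero vector is treated apart. *)
Lemma l2norm_mulmx m n (M : 'M[R]_(m, n)) (x : 'cV[R]_n) :
  l2norm (M *m x) <= spectral_norm M * l2norm x.
Proof.
have [x0|x0] := eqVneq (l2norm x) 0.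
  by rewrite x0 mulr0 (l2norm_eq0 _ _ x0) mulmx0 l2norm0.
have xgt0 : 0 < l2norm x by rewrite lt_neqAle eq_sym x0 l2norm_ge0.
have := l2norm_mulmx_unit_ball _ _ M ((l2norm x)^-1 *: x).
rewrite -scalemxAr !l2normZ ger0_norm ?invr_ge0 ?l2norm_ge0 // mulVf //.
by move=> /(_ (lexx 1)); rewrite mulrC ler_pdivrMr.
Qed.

Lemma dot_mulmx_le m n (M : 'M[R]_(m, n)) (y : 'cV[R]_m) (x : 'cV[R]_n) :
  `|dot y (M *m x)| <= spectral_norm M * (l2norm y * l2norm x).
Proof.
apply: le_trans (cauchy_schwarz _ _ _) _; rewrite mulrCA.
by rewrite ler_wpM2l ?l2norm_ge0 ?l2norm_mulmx.
Qed.

(** Duality: the choice [y = M *m x] turns the bilinear bound into a bound on the square of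
    [l2norm (M *m x)], from which one factor cancels. *)
Lemma spectral_norm_le_dot m n (M : 'M[R]_(m, n)) (b : R) : 0 <= b ->
  (forall y x, dot y (M *m x) <= b * (l2norm y * l2norm x)) ->
  spectral_norm M <= b.
Proof.
move=> b0 hb; apply: spectral_norm_le => x x1.
have [->//|y0] := eqVneq (l2norm (M *m x)) 0.
have ygt0 : 0 < l2norm (M *m x) by rewrite lt_neqAle eq_sym y0 l2norm_ge0.
have := hb (M *m x) x; rewrite dotvv expr2 mulrCA ler_pM2l // => /le_trans.
by apply; rewrite ler_piMr.
Qed.

Lemma dot_indicatorl n (S : {set 'I_n}) (x : 'cV[R]_n) :
  dot (indicator S) x = \sum_(i in S) x i 0.
Proof.
rewrite [RHS]big_mkcond; apply: eq_bigr => i _; rewrite mxE.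
by case: (i \in S); rewrite ?mul1r ?mul0r.
Qed.

Lemma l2norm_indicator n (S : {set 'I_n}) :
  l2norm (indicator S) ^+ 2 = #|S|%:R :> R.
Proof.
rewrite -dotvv dot_indicatorl -sum1_card natr_sum.
by apply: eq_bigr => i iS; rewrite mxE iS.
Qed.

(** The block sum is the quadratic form of the restricted matrix at [indicator T], whose squared
    length is [#|T|]; the restriction to [S] does not affect it because [T] lies in [S]. *)
Lemma block_sum_le n (M : 'M[R]_n) (S T : {set 'I_n}) : T \subset S ->
  `|\sum_(i in T) \sum_(j in T) M i j|
    <= spectral_norm (mx_restrict M S S) * #|T|%:R.
Proof.
move=> /fintype.subsetP TS.
have -> : \sum_(i in T) \sum_(j in T) M i j =
          dot (indicator T) (mx_restrict M S S *m indicator T).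
  rewrite dot_indicatorl; apply: eq_bigr => i iT.
  rewrite mxE [LHS]big_mkcond; apply: eq_bigr => j _; rewrite !mxE (TS i iT).
  by case: ifPn => [/TS ->|_]; rewrite ?mulr1 ?mulr0.
by rewrite -l2norm_indicator expr2; exact: dot_mulmx_le.
Qed.

Lemma sum_subc n (A : 'M[R]_n) (a : R) (S : {set 'I_n}) :
  \sum_(i in S) \sum_(j in S) mx_subc A a i j =
  \sum_(i in S) \sum_(j in S) A i j - a * #|S|%:R ^+ 2.
Proof.
transitivity (\sum_(i in S) (\sum_(j in S) A i j - a * #|S|%:R)).
  apply: eq_bigr => i _; rewrite mulr_natr -sumr_const -sumrB.
  by apply: eq_bigr => j _; rewrite mxE.
by rewrite sumrB sumr_const -mulr_natr; ring.
Qed.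

(** Recentering adds a multiple of the rank-one matrix formed from [indicator S], so the bilinear
    form changes by a product of two dot products. *)
Lemma dot_restrict_subc n (A : 'M[R]_n) (a b : R) (S : {set 'I_n})
    (y x : 'cV[R]_n) :
  dot y (mx_restrict (mx_subc A b) S S *m x) =
  dot y (mx_restrict (mx_subc A a) S S *m x)
    + (a - b) * (dot (indicator S) y * dot (indicator S) x).
Proof.
rewrite (dotC _ (indicator S) y) {3}/dot mulr_suml mulr_sumr -big_split /=.
apply: eq_bigr => i _; rewrite 3!mxE.
rewrite [X in _ = _ + (a - b) * X](_ : _ =
   y i 0 * ((i \in S)%:R * dot (indicator S) x)); last by ring.
rewrite [(a - b) * _]mulrCA -mulrDr; congr (_ * _).
rewrite /dot !mulr_sumr -big_split /=; apply: eq_bigr => j _; rewrite !mxE.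
by case: (i \in S); case: (j \in S) => /=; ring.
Qed.

(** Cauchy-Schwarz bounds the rank-one correction by [#|S|], the squared length of [indicator S]. *)
Lemma spectral_norm_shift n (A : 'M[R]_n) (a b : R) (S : {set 'I_n}) :
  spectral_norm (mx_restrict (mx_subc A b) S S)
    <= spectral_norm (mx_restrict (mx_subc A a) S S) + `|a - b| * #|S|%:R.
Proof.
apply: spectral_norm_le_dot => [|y x].
  by rewrite addr_ge0 ?mulr_ge0 ?spectral_norm_ge0.
rewrite (dot_restrict_subc _ _ a) [leRHS]mulrDl lerD //.
  by apply: le_trans (ler_norm _) _; exact: dot_mulmx_le.
apply: le_trans (ler_norm _) _; rewrite normrM -mulrA ler_wpM2l // normrM.
rewrite -l2norm_indicator expr2 mulrACA.
by rewrite ler_pM // cauchy_schwarz.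
Qed.

Lemma density_mul n (A : 'M[R]_n) (S : {set 'I_n}) : (0 < #|S|)%N ->
  density A S * #|S|%:R ^+ 2 = \sum_(i in S) \sum_(j in S) A i j.
Proof. by move=> S0; rewrite divfK // expf_neq0 // pnatr_eq0 -lt0n. Qed.

End SpectralNorm.

Theorem theorem4p7 (R : realType) (c c1 : R) (hc : 0 < c) (hc1 : 0 < c1)
    (n : nat) (hn : (0 < n)%N)
    (alpha1 alpha2 p : R)
    (halpha1 : 0 <= alpha1 < 1 / 2) (halpha2 : 0 <= alpha2 < 1 / 2)
    (hp : 0 <= p <= 1)
    (A : 'M[R]_n) (hA : adjacency_matrix A)
    (F : {set 'I_n}) (hF : regular_set c c1 A alpha1 alpha2 p F)
    (Shat : {set 'I_n}) (hS : is_argmin_centered_norm A Shat) :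
  spectral_norm (mx_restrict (mx_subc A (density A Shat)) Shat Shat)
    <= 2 * n%:R * eta c p n
  /\ `|density A Shat - p| <= 3 / (1 / 2 - alpha1) * eta c p n.
Proof.
have [smallC regF _] := hF; have [bigS minS] := hS.
have {}regF := regF F (subxx F).
have n0 : 0 < n%:R :> R by rewrite ltr0n.
have cardF : #|F|%:R + #|~: F|%:R = n%:R :> R.
  by rewrite -natrD cardsC card_ord.
(* Since [alpha1 < 1 / 2], the set [F] is large enough to compete with [Shat] in the
   minimization. *)
have bigF : n%:R / 2 <= #|F|%:R :> R by nra.
have F0 : 0 < #|F|%:R :> R by lra.
have normS : spectral_norm (mx_restrict (mx_subc A (density A Shat)) Shat Shat)
    <= 2 * n%:R * eta c p n.
  apply: le_trans (minS F bigF) _.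
  apply: le_trans (spectral_norm_shift _ A p _ F) _.
  (* One of the two factors [#|F|] cancels, leaving exactly the extra term of the shift. *)
  have := block_sum_le _ (mx_subc A p) F F (subxx F).
  rewrite sum_subc -density_mul -?(ltr0n R) // -mulrBl normrM distrC.
  rewrite [`|_ ^+ 2|]ger0_norm ?sqr_ge0 // expr2 mulrA ler_pM2r // => dens.
  lra.
split=> //.
set T := F :&: Shat.
(* [Shat] has at least [n / 2] elements and loses at most the [alpha1 * n] that lie outside [F]. *)
have bigT : (1 / 2 - alpha1) * n%:R <= #|T|%:R :> R.
  have : #|Shat|%:R <= #|T|%:R + #|~: F|%:R :> R.
    rewrite -natrD ler_nat -(cardsID F Shat) finset.setIC leq_add2l.
    by rewrite finset.setDE subset_leq_card // finset.subsetIr.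
  lra.
have a0 : 0 < 1 / 2 - alpha1 by lra.
have T0 : 0 < #|T|%:R :> R by apply: lt_le_trans bigT; exact: mulr_gt0.
have regT := block_sum_le _ (mx_subc A p) F T (finset.subsetIl F Shat).
have minT := block_sum_le _ (mx_subc A (density A Shat)) Shat T
  (finset.subsetIr F Shat).
(* The constant is 3 = 1 + 2: one [n * eta] from regularity of [F], two from [normS]. *)
have diff : `|density A Shat - p| * #|T|%:R <= 3 * n%:R * eta c p n.
  rewrite -(ler_pM2r T0) -[leLHS]mulrA -[#|T|%:R * _]expr2.
  rewrite -[X in _ * X](ger0_norm (sqr_ge0 _)) -normrM mulrBl.
  set s := \sum_(i in T) \sum_(j in T) A i j.
  (* The uncentered sum [s] over [T] cancels in the difference of the two centered sums. *)
  rewrite -[X in `|X|](_ : (s - p * #|T|%:R ^+ 2)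
     - (s - density A Shat * #|T|%:R ^+ 2) = _); last by ring.
  rewrite -!sum_subc; apply: le_trans (ler_normB _ _) _.
  apply: le_trans (lerD regT minT) _; rewrite -mulrDl ler_wpM2r //; lra.
(* Multiplying through by [n] lets [bigT] replace [(1 / 2 - alpha1) * n] by [#|T|], which reduces
   the claim to [diff]. *)
rewrite mulrAC ler_pdivlMr // -(ler_pM2r n0) -mulrA.
apply: le_trans (ler_wpM2l (normr_ge0 _) bigT) _.
by rewrite mulrAC.
Qed.
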